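(* Let $E$ be a pseudo effect algebra satisfying (RDP)$_1$. Then the state space $\mathcal S(E)$ is either empty or a nonempty Choquet simplex.
   Context: A pseudo effect algebra is a partial algebra $(E;+,0,1)$, with $+$ a partial binary operation and $0,1$ constants, such that for all $a,b,c\in E$: (i) $a+b$ and $(a+b)+c$ exist iff $b+c$ and $a+(b+c)$ exist, and then $(a+b)+c=a+(b+c)$; (ii) there are exactly one $d\in E$ and exactly one $e\in E$ with $a+d=e+a=1$; (iii) if $a+b$ exists, there are $d,e\in E$ with $a+b=d+a=b+e$; (iv) if $1+a$ or $a+1$ exists, then $a=0$. The order is $a\le b$ iff there is $c\in E$ with $a+c=b$. For $a,b\in E$, $a\ \mathbf{com}\ b$ means that for all $a_1\le a$ and $b_1\le b$ in $E$, $a_1$ and $b_1$ commute. (RDP)$_1$: for all $a_1,a_2,b_1,b_2\in E$ with $a_1+a_2=b_1+b_2$ there are $d_1,d_2,d_3,d_4\in E$ with $d_1+d_2=a_1$, $d_3+d_4=a_2$, $d_1+d_3=b_1$, $d_2+d_4=b_2$ and $d_2\ \mathbf{com}\ d_3$. A state on $E$ is a map $s:E\to[0,1]$ with $s(a+b)=s(a)+s(b)$ whenever $a+b$ is defined and $s(1)=1$; $\mathcal S(E)$ is the convex set of all states with the topology of pointwise (weak) convergence, viewed in the locally convex space $\mathbb R^E$. A convex cone in a real vector space $V$ is a subset $C$ containing $0$ and closed under linear combinations with nonnegative coefficients; it is strict if $C\cap(-C)=\{0\}$, and then $x\le_C y$ iff $y-x\in C$ is a partial order. A lattice cone is a strict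 convex cone $C$ that is a lattice under $\le_C$. A base for a convex cone $C$ is a convex subset $K\subseteq C$ such that every nonzero $y\in C$ is uniquely of the form $y=\alpha x$ with $\alpha\ge0$ real, $x\in K$. A simplex is a convex subset of a real vector space that is affinely isomorphic (via a bijection preserving convex combinations in both directions) to a base for a lattice cone in some real vector space. A Choquet simplex is a compact simplex in a locally convex Hausdorff space. *)

(* Defs.v *)
From HB Require Import structures.
From mathcomp Require Import all_boot all_order all_algebra.
From mathcomp Require Import all_classical all_reals.
From mathcomp Require Import interval_inference topology tvs convex.
From mathcomp Require Import normedtype.

Set Implicit Arguments.
Unset Strict Implicit.
Unset Printing Implicit Defensive.

Import Order.TTheory GRing.Theory Num.Theory.
Import numFieldNormedType.Exports.

Local Open Scope classical_set_scope.
Local Open Scope convex_scope.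
Local Open Scope ring_scope.

(** The function space [{ptws I -> V}] as a locally convex space

    MathComp-Analysis provides the product topology on [{ptws I -> V}] and the
    pointwise module structure on [I -> V]; these are assembled into a
    [tvsType], so that R^I is available as a locally convex space. *)
Section ptws_tvs.
Context (K : numFieldType) (I : Type) (V : tvsType K).

HB.instance Definition _ := GRing.Lmodule.copy {ptws I -> V} (I -> V).

Local Notation X := {ptws I -> V}.

Lemma ptws_cvgP (F : set_system X) (f : X) : Filter F ->
  F --> f <-> forall i, (fun g : X => g i) @ F --> f i.
Proof.
move=> FF; split=> [Ff i A|Ff].
  rewrite nbhsE => -[B [oB Bf] BA].
  move/cvg_sup : Ff => /(_ i); apply.
  exists ((fun g : X => g i) @^-1` B); split=> //; first by exists B.
  by move=> g /BA.
apply/cvg_sup => i A [_ [[B oB <-] /= Bf BA]].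
apply: (filterS BA); apply: (Ff i); exact: open_nbhs_nbhs.
Qed.

Lemma ptws_eval_continuous (i : I) : continuous (fun g : X => g i).
Proof. by move=> f; exact: (iffLR (ptws_cvgP f (nbhs_filter f)) cvg_id). Qed.

Let ptws_add_continuous : continuous (fun x : X * X => x.1 + x.2).
Proof.
move=> fg; apply/ptws_cvgP => i; rewrite -fmap_comp.
apply: (@continuous2_cvg _ V V V _ _ (fun x : X * X => x.1 i)
  (fun x : X * X => x.2 i) (fun u v : V => u + v) (fg.1 i) (fg.2 i)).
- exact: (@add_continuous V (fg.1 i, fg.2 i)).
- apply: (@continuous_comp (X * X)%type X V fst (fun h => h i)).
    exact: cvg_fst.
  exact: ptws_eval_continuous.
- apply: (@continuous_comp (X * X)%type X V snd (fun h => h i)).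
    exact: cvg_snd.
  exact: ptws_eval_continuous.
Qed.

Let ptws_scale_continuous : continuous (fun z : K^o * X => z.1 *: z.2).
Proof.
move=> kf; apply/ptws_cvgP => i; rewrite -fmap_comp.
apply: (@continuous2_cvg _ K^o V V _ _ (fun z : K^o * X => z.1)
  (fun z : K^o * X => z.2 i) (fun (c : K^o) (v : V) => c *: v)
  kf.1 (kf.2 i)).
- exact: (@scale_continuous K V (kf.1, kf.2 i)).
- exact: cvg_fst.
- apply: (@continuous_comp (K^o * X)%type X V snd (fun h => h i)).
    exact: cvg_snd.
  exact: ptws_eval_continuous.
Qed.

Let ptws_locally_convex :
  exists2 B : set_system X, (forall b, b \in B -> convex_set b) & basis B.
Proof.
exists [set A | open A /\ convex_set A]; first by move=> A; rewrite inE => -[].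
split=> [A []//|f].
have FF : Filter (filter_from
    [set U : set X | (open U /\ convex_set U) /\ U f] id).
  apply: filter_from_filter.
    by exists setT; split=> //; split; [exact: openT|move=> x y l; rewrite !inE].
  move=> A B [[oA cA] Af] [[oB cB] Bf]; exists (A `&` B) => //.
  split=> //; split; first exact: openI.
  move=> x y l /set_mem[Ax Bx] /set_mem[Ay By]; apply/mem_set; split.
    by apply/set_mem/cA; exact/mem_set.
  by apply/set_mem/cB; exact/mem_set.
apply/ptws_cvgP => i A Afi.
have [B cB [oB bB]] := @locally_convex K V.
have [C [BC Cf] CA] := bB (f i) A Afi.
exists ((fun g : X => g i) @^-1` C); last by move=> g /CA.
split=> //; split.
  by apply: open_comp (oB _ BC) => g _; exact: ptws_eval_continuous.
move=> x y l /set_mem Cx /set_mem Cy; apply/mem_set.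
have /cB cC : C \in B by exact/mem_set.
by apply/set_mem; apply: (cC (x i) (y i) l); exact/mem_set.
Qed.

HB.instance Definition _ := PreTopologicalNmodule_isTopologicalNmodule.Build
  X ptws_add_continuous.
HB.instance Definition _ := TopologicalNmodule_isTopologicalLmodule.Build
  K X ptws_scale_continuous.
HB.instance Definition _ := Uniform_isTvs.Build K X ptws_locally_convex.

End ptws_tvs.

(** Partiality of the sum is expressed by [option]: [pea_add a b = Some c] says
    that [a + b] exists and equals [c]. *)
HB.mixin Record isPseudoEffectAlgebra (E : Type) := {
  pea_add : E -> E -> option E;
  pea_zero : E;
  pea_one : E;
  (* Both sides are [None] when the iterated sum does not exist. *)
  pea_addA : forall a b c : E,
    obind (fun d => pea_add d c) (pea_add a b) =
    obind (fun d => pea_add a d) (pea_add b c);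
  pea_compr : forall a : E, exists! d, pea_add a d = Some pea_one;
  pea_compl : forall a : E, exists! e, pea_add e a = Some pea_one;
  pea_conj : forall a b c : E, pea_add a b = Some c ->
    exists d e, pea_add d a = Some c /\ pea_add b e = Some c;
  pea_add1 : forall a : E,
    isSome (pea_add pea_one a) || isSome (pea_add a pea_one) -> a = pea_zero
}.

#[short(type="pseudoEffectAlgType")]
HB.structure Definition PseudoEffectAlgebra :=
  {E of isPseudoEffectAlgebra E}.

Section PseudoEffectAlgebraDefs.
Context (E : pseudoEffectAlgType).
Implicit Types a b c d : E.

Definition pea_le a b := exists c, pea_add a c = Some b.

(** Both sums exist and are equal, or neither sum exists. *)
Definition pea_commute a b := pea_add a b = pea_add b a.

Definition pea_com a b :=
  forall a1 b1, pea_le a1 a -> pea_le b1 b -> pea_commute a1 b1.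

Definition RDP1 := forall a1 a2 b1 b2,
  isSome (pea_add a1 a2) -> pea_add a1 a2 = pea_add b1 b2 ->
  exists d1 d2 d3 d4,
    [/\ pea_add d1 d2 = Some a1, pea_add d3 d4 = Some a2,
        pea_add d1 d3 = Some b1, pea_add d2 d4 = Some b2 & pea_com d2 d3].

Definition is_state (R : realType) (s : E -> R) :=
  [/\ forall a, 0 <= s a <= 1,
      forall a b c, pea_add a b = Some c -> s c = s a + s b &
      s pea_one = 1].

(** As a subset of R^E with the topology of pointwise convergence. *)
Definition state_space (R : realType) : set {ptws E -> R^o} :=
  [set s | is_state s].

End PseudoEffectAlgebraDefs.

Arguments state_space E R : clear implicits.

Section Cones.
Context (R : realType) (V : lmodType R).
Implicit Types (C K : set V) (x y z w : V).

Definition convex_cone C :=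
  C 0 /\ forall (a b : R) x y,
    0 <= a -> 0 <= b -> C x -> C y -> C (a *: x + b *: y).

Definition strict_cone C := C `&` [set - x | x in C] = [set 0].

Definition cone_le C x y := C (y - x).

Definition cone_join C x y z :=
  [/\ C z, cone_le C x z, cone_le C y z &
      forall w, C w -> cone_le C x w -> cone_le C y w -> cone_le C z w].

Definition cone_meet C x y z :=
  [/\ C z, cone_le C z x, cone_le C z y &
      forall w, C w -> cone_le C w x -> cone_le C w y -> cone_le C w z].

Definition lattice_cone C :=
  [/\ convex_cone C, strict_cone C &
      forall x y, C x -> C y ->
        (exists z, cone_join C x y z) /\ (exists z, cone_meet C x y z)].

Definition cone_base C K :=
  [/\ K `<=` C, convex_set K &
      forall y, C y -> y <> 0 ->
        exists! p : R * V, [/\ 0 <= p.1, K p.2 & y = p.1 *: p.2]].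

End Cones.

Definition affine_on (R : realType) (V W : lmodType R) (K : set V)
    (f : convex_lmodType V -> convex_lmodType W) :=
  forall (t : {i01 R}) (x y : convex_lmodType V), K x -> K y ->
    f (x <| t |> y) = f x <| t |> f y.

Definition affinely_isomorphic (R : realType) (V W : lmodType R)
    (K : set V) (L : set W) :=
  exists (f : V -> W) (g : W -> V),
    [/\ {homo f : x / K x >-> L x}, {homo g : y / L y >-> K y},
        forall x, K x -> g (f x) = x & forall y, L y -> f (g y) = y] /\
    (affine_on K f /\ affine_on L g).

Definition simplex (R : realType) (V : lmodType R) (K : set V) :=
  convex_set K /\
  exists (W : lmodType R) (C L : set W),
    [/\ lattice_cone C, cone_base C L & affinely_isomorphic K L].

Definition choquet_simplex (R : realType) (V : tvsType R) (K : set V) :=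
  [/\ hausdorff_space V, compact K & simplex K].

(* Main.v *)
Require Import Defs.
From mathcomp Require Import all_boot all_order all_algebra.
From mathcomp Require Import all_classical all_reals.
From mathcomp Require Import topology tvs normedtype.
From mathcomp Require Import interval_inference convex lra.

Set Implicit Arguments.
Unset Strict Implicit.
Unset Printing Implicit Defensive.

Import Order.TTheory GRing.Theory Num.Theory.
Import numFieldNormedType.Exports.

Local Open Scope classical_set_scope.
Local Open Scope ring_scope.

(** The states are the points [m] with [m 1 = 1] of the cone of all
    nonnegative additive functionals [m : E -> R], and each nonzero element of
    this cone is uniquely a positive multiple of a state
    ([state_space_base]).  The state space being literally a base, the simplex
    property reduces to the cone being a lattice, which is the classical
    Riesz--Kantorovich argument: the meet of [m] and [n] is
    [(m /\ n)(c) = inf {m a + n b | a + b = c}], and the join is then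
    [m + n - m /\ n].

    The crux is the additivity of the meet ([pea_measure_meet]).  Given
    [c = c1 + c2], a decomposition [a + b] of [c] is refined through Riesz
    decomposition into decompositions of [c1] and [c2], so the meet is
    superadditive.  Conversely, decompositions [c1 = a1 + b1] and
    [c2 = a2 + b2] give [c = a1 + b1 + a2 + b2], whose middle terms have to be
    exchanged.  Noncommutativity replaces [b1] by a conjugate, but additive
    functionals do not distinguish conjugate elements, so the meet is also
    subadditive.

    For the topology, the states form a closed subset of the cube [0, 1]^E,
    which is compact by Tychonoff's theorem. *)

(** * Sums in a pseudo effect algebra *)

Section PseudoEffectAlgebraSums.
Context (E : pseudoEffectAlgType).
Implicit Types a b c d e : E.

(** Only zero can be added to the unit, so [1 + 0 = 1] and [e + (a + 0)] equals
    [(e + a) + 0 = 1] for the left complement [e] of [a]; uniqueness of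
    complements then cancels [e]. *)
Lemma pea_addr0 a : pea_add a pea_zero = Some a.
Proof.
have [z [z1 _]] := pea_compr (pea_one : E).
have z0 : z = pea_zero by apply: pea_add1; rewrite z1.
rewrite {}z0 in z1.
have [e [e1 _]] := pea_compl a.
have [d [d1 uniq_d]] := pea_compr e.
have := pea_addA e a pea_zero; rewrite e1 /= z1.
case: (pea_add a pea_zero) => //= a0 /esym /uniq_d <-.
by rewrite (uniq_d _ e1).
Qed.

Lemma pea_add0r a : pea_add pea_zero a = Some a.
Proof.
have [z [z1 _]] := pea_compl (pea_one : E).
have z0 : z = pea_zero by apply: pea_add1; rewrite z1 orbT.
rewrite {}z0 in z1.
have [d [d1 _]] := pea_compr a.
have [e [e1 uniq_e]] := pea_compl d.
have := pea_addA pea_zero a d; rewrite d1 /= z1.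
case: (pea_add pea_zero a) => //= a0 /uniq_e <-.
by rewrite (uniq_e _ d1).
Qed.

Lemma pea_addA_left a b c d ab : pea_add a b = Some ab ->
  pea_add ab c = Some d ->
  exists2 bc, pea_add b c = Some bc & pea_add a bc = Some d.
Proof.
move=> ab_def abc_def; have := pea_addA a b c.
by rewrite ab_def /= abc_def; case: (pea_add b c) => //= bc /esym; exists bc.
Qed.

Lemma pea_addA_right a b c d bc : pea_add b c = Some bc ->
  pea_add a bc = Some d ->
  exists2 ab, pea_add a b = Some ab & pea_add ab c = Some d.
Proof.
move=> bc_def abc_def; have := pea_addA a b c.
by rewrite bc_def /= abc_def; case: (pea_add a b) => //= ab; exists ab.
Qed.

(** Moving [a2] to the left past [b1] is possible at the cost of replacing
    [b1] by a conjugate [e].  The equations through [f] record this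
    conjugacy, which forces every additive functional to agree on [b1] and
    [e]. *)
Lemma pea_add_interchange a1 b1 a2 b2 c1 c2 c :
  pea_add a1 b1 = Some c1 -> pea_add a2 b2 = Some c2 ->
  pea_add c1 c2 = Some c ->
  exists a e b f,
    [/\ pea_add b1 a2 = Some f, pea_add a2 e = Some f,
        pea_add a1 a2 = Some a, pea_add e b2 = Some b & pea_add a b = Some c].
Proof.
move=> c1_def c2_def c_def.
have [b1c2 b1c2_def a1_b1c2] := pea_addA_left c1_def c_def.
have [f f_def fb2] := pea_addA_right c2_def b1c2_def.
have [_ [e [_ f_def']]] := pea_conj _ _ _ f_def.
have [b b_def a2b] := pea_addA_left f_def' fb2.
have [a a_def ab] := pea_addA_right a2b a1_b1c2.
by exists a, e, b, f.
Qed.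

End PseudoEffectAlgebraSums.

(** * The cone of nonnegative additive functionals *)

Section AdditiveFunctionals.
Context (R : realType) (E : pseudoEffectAlgType).
Implicit Types (m n s : E -> R) (a b c : E).

Definition pea_additive m :=
  forall a b c, pea_add a b = Some c -> m c = m a + m b.

Definition pea_measure m := (forall a, 0 <= m a) /\ pea_additive m.

Lemma pea_additive0 m : pea_additive m -> m pea_zero = 0.
Proof. by move=> /(_ _ _ _ (pea_addr0 pea_zero)) /eqP; lra. Qed.

Lemma pea_measure_le1 m a : pea_measure m -> m a <= m pea_one.
Proof.
move=> [m_ge0 mD]; have [d [/mD -> _]] := pea_compr a.
by rewrite lerDl.
Qed.

(** Bounding all values by the value at the unit gives the upper half of
    the condition that a state takes values in [0, 1]. *)
Lemma is_stateE s : is_state s <-> pea_measure s /\ s pea_one = 1.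
Proof.
split=> [[s01 sD s1]|[ms s1]].
  by split=> //; split=> // a; have /andP[] := s01 a.
split=> //; last exact: ms.2.
by move=> a; rewrite ms.1 -s1 pea_measure_le1.
Qed.

Definition meet_values m n c : set R :=
  [set m p.1 + n p.2 | p in [set p : E * E | pea_add p.1 p.2 = Some c]].

Definition pea_meet m n c : R := inf (meet_values m n c).

Lemma pea_meet_glb m n c r :
  (forall a b, pea_add a b = Some c -> r <= m a + n b) -> r <= pea_meet m n c.
Proof.
move=> r_lb; apply: lb_le_inf => [|_ [[a b] /= ab <-]]; last exact: r_lb.
by exists (m c + n pea_zero), (c, pea_zero) => //=; exact: pea_addr0.
Qed.

Lemma pea_meet_le m n a b c : pea_measure m -> pea_measure n ->
  pea_add a b = Some c -> pea_meet m n c <= m a + n b.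
Proof.
move=> [m_ge0 _] [n_ge0 _] ab; apply: ge_inf; last by exists (a, b).
by exists 0 => _ [p _ <-]; rewrite addr_ge0.
Qed.

Lemma pea_meet_lel m n a : pea_measure m -> pea_measure n ->
  pea_meet m n a <= m a.
Proof.
move=> mm mn; have := pea_meet_le mm mn (pea_addr0 a).
by rewrite (pea_additive0 mn.2) addr0.
Qed.

Lemma pea_meet_ler m n a : pea_measure m -> pea_measure n ->
  pea_meet m n a <= n a.
Proof.
move=> mm mn; have := pea_meet_le mm mn (pea_add0r a).
by rewrite (pea_additive0 mm.2) add0r.
Qed.

(** The Riesz--Kantorovich argument: conjugation invariance gives
    subadditivity, Riesz decomposition gives superadditivity. *)
Lemma pea_measure_meet m n : RDP1 E -> pea_measure m -> pea_measure n ->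
  pea_measure (pea_meet m n).
Proof.
move=> rdp mm mn; have [[m_ge0 mD] [n_ge0 nD]] := (mm, mn); split=> [c|].
  by apply: pea_meet_glb => a b _; rewrite addr_ge0.
move=> c1 c2 c c12; apply/eqP; rewrite eq_le; apply/andP; split.
  rewrite -lerBlDr; apply: pea_meet_glb => a1 b1 ab1.
  rewrite lerBlDr addrC -lerBlDr; apply: pea_meet_glb => a2 b2 ab2.
  have [a [e [b [f [f_def f_def' a_def b_def ab]]]]] :=
    pea_add_interchange ab1 ab2 c12.
  have := pea_meet_le mm mn ab.
  rewrite (mD _ _ _ a_def) (nD _ _ _ b_def).
  (* [n b1 = n e], both being [n f - n a2]. *)
  have := nD _ _ _ f_def; rewrite (nD _ _ _ f_def').
  lra.
apply: pea_meet_glb => a b ab.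
have ab_c : pea_add a b = pea_add c1 c2 by rewrite ab.
have ab_some : isSome (pea_add a b) by rewrite ab.
have [d1 [d2 [d3 [d4 [a_def b_def c1_def c2_def _]]]]] :=
  rdp a b c1 c2 ab_some ab_c.
have := lerD (pea_meet_le mm mn c1_def) (pea_meet_le mm mn c2_def).
by rewrite (mD _ _ _ a_def) (nD _ _ _ b_def) addrACA.
Qed.

Lemma pea_measureB m n : pea_measure m -> pea_measure n ->
  (forall a, n a <= m a) -> pea_measure (fun a => m a - n a).
Proof.
move=> [_ mD] [_ nD] le_nm; split=> [a|a b c abc].
  by rewrite subr_ge0.
by rewrite (mD _ _ _ abc) (nD _ _ _ abc) opprD addrACA.
Qed.

End AdditiveFunctionals.

(** * The simplex of states *)

Section MeasureCone.
Context (R : realType) (E : pseudoEffectAlgType).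
Let V : tvsType R := {ptws E -> R^o}.
Implicit Types (x y : V).

Definition measure_cone : set {ptws E -> R^o} := [set m | pea_measure m].

Lemma measure_cone_convex : convex_cone (V := V) measure_cone.
Proof.
split=> [|r t x y r0 t0 [x0 xD] [y0 yD]].
  by split=> [a|a b c _] /=; rewrite ?addr0.
split=> [a|a b c abc].
  by rewrite addr_ge0 // mulr_ge0.
rewrite -[LHS]/(r * x c + t * y c).
rewrite -[RHS]/(r * x a + t * y a + (r * x b + t * y b)).
by rewrite (xD _ _ _ abc) (yD _ _ _ abc) !mulrDr addrACA.
Qed.

Lemma measure_cone_strict : strict_cone (V := V) measure_cone.
Proof.
apply/seteqP; split=> [x [[x0 _] [y [y0 _] yx]]|_ ->].
  apply/funext => a; apply/eqP; rewrite eq_le x0 andbT -yx.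
  by rewrite /= oppr_le0.
have [c0 _] := measure_cone_convex.
by split=> //; exists 0 => //; rewrite oppr0.
Qed.

Lemma measure_cone_leP x y :
  cone_le (V := V) measure_cone x y -> forall a, x a <= y a.
Proof. by move=> [xy _] a; have := xy a; rewrite subr_ge0. Qed.

(** A lower bound [w] of [x] and [y] lies below each
    [x a + y b >= w a + w b = w c], hence below the infimum. *)
Lemma measure_cone_meet x y : RDP1 E ->
  measure_cone x -> measure_cone y ->
  cone_meet (V := V) measure_cone x y (pea_meet x y).
Proof.
move=> rdp mx my; have mxy := pea_measure_meet rdp mx my.
split=> // [||w mw wx wy].
- apply: pea_measureB => // a; exact: pea_meet_lel.
- apply: pea_measureB => // a; exact: pea_meet_ler.
apply: pea_measureB => // c; apply: pea_meet_glb => a b /mw.2 ->.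
by rewrite lerD ?measure_cone_leP.
Qed.

(** The join is forced by the identity [x \/ y = x + y - x /\ y] valid in any
    lattice-ordered vector space. *)
Lemma measure_cone_join x y : RDP1 E ->
  measure_cone x -> measure_cone y ->
  cone_join (V := V) measure_cone x y (x + y - (pea_meet x y : V)).
Proof.
move=> rdp mx my; have mxy := pea_measure_meet rdp mx my.
have [_ coneD] := measure_cone_convex.
have meet_lex a := pea_meet_lel a mx my.
have meet_ley a := pea_meet_ler a mx my.
have mxDy : measure_cone (x + y).
  by have := coneD 1 1 x y ler01 ler01 mx my; rewrite !scale1r.
have mz : measure_cone (x + y - (pea_meet x y : V)).
  apply: (pea_measureB mxDy mxy) => a.
  by apply: (le_trans (meet_lex a)); rewrite lerDl my.1.
split=> // [||w mw xw yw].
- rewrite /cone_le -(addrA x) (addrC x) addrK.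
  exact: (pea_measureB my mxy).
- rewrite /cone_le addrAC addrK.
  exact: (pea_measureB mx mxy).
apply: (pea_measureB mw mz) => c.
rewrite -[leLHS]/(x c + y c - pea_meet x y c) lerBlDr -lerBlDl.
(* On a decomposition [c = a + b] the bound splits by additivity into
   [y a <= w a] and [x b <= w b]. *)
apply: pea_meet_glb => a b ab; rewrite (mx.2 _ _ _ ab) (my.2 _ _ _ ab).
rewrite (mw.2 _ _ _ ab).
by have := measure_cone_leP yw a; have := measure_cone_leP xw b; lra.
Qed.

Lemma measure_cone_lattice : RDP1 E -> lattice_cone (V := V) measure_cone.
Proof.
move=> rdp; split; [exact: measure_cone_convex|exact: measure_cone_strict|].
move=> x y mx my; split; eexists.
- exact: measure_cone_join.
- exact: measure_cone_meet.
Qed.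

Lemma state_spaceE :
  state_space E R = measure_cone `&` [set s | s pea_one = 1].
Proof. by apply/seteqP; split=> s /is_stateE. Qed.

Lemma state_space_convex : convex_set (M := V) (state_space E R).
Proof.
have [_ coneD] := measure_cone_convex.
move=> x y t /set_mem; rewrite state_spaceE => -[mx x1] /set_mem[my y1].
apply/mem_set; split.
  by apply: (coneD t%:num (1 - t%:num) x y _ _ mx my); rewrite ?subr_ge0.
change (t%:num * x pea_one + (1 - t%:num) * y pea_one = 1).
by rewrite x1 y1 !mulr1 addrC subrK.
Qed.

(** A nonzero measure has positive mass at the unit, because that value
    dominates all others; dividing by it gives the only possible state. *)
Lemma state_space_base : cone_base (V := V) measure_cone (state_space E R).
Proof.
split; [by rewrite state_spaceE => s []|exact: state_space_convex|].
move=> y my y0; have [_ coneD] := measure_cone_convex.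
have y1_ge0 : 0 <= y pea_one := my.1 _.
have y1_neq0 : y pea_one != 0.
  apply/eqP => y1; apply: y0; apply/funext => a; apply/eqP.
  by rewrite eq_le -[leRHS]y1 pea_measure_le1 ?my.1.
exists (y pea_one, (y pea_one)^-1 *: y); split=> /=.
  split=> //; last by rewrite scalerA divff // scale1r.
  rewrite state_spaceE; split; last exact: mulVf.
  have := coneD (y pea_one)^-1 0 y 0; rewrite scaler0 addr0; apply=> //.
    by rewrite invr_ge0.
  exact: measure_cone_convex.1.
move=> [r s] [/= _]; rewrite state_spaceE => -[_ s1] ys.
have -> : y pea_one = r by rewrite ys -[LHS]/(r * s pea_one) s1 mulr1.
have r_neq0 : r != 0.
  by apply: contraNN y1_neq0 => /eqP r0; rewrite ys r0 scale0r.
by rewrite ys scalerA mulVf // scale1r.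
Qed.

Lemma state_space_simplex : RDP1 E -> simplex (V := V) (state_space E R).
Proof.
move=> rdp; split; first exact: state_space_convex.
exists V, measure_cone, (state_space E R); split.
- exact: measure_cone_lattice.
- exact: state_space_base.
by exists id, id; split; split.
Qed.

(** * Compactness *)

Lemma ptws_hausdorff : hausdorff_space V.
Proof.
exact: (@hausdorff_product {classic E} (fun=> R^o)
  (fun=> @norm_hausdorff R R^o)).
Qed.

Lemma state_space_closed : closed (state_space E R : set V).
Proof.
have eval_cont a : continuous (fun s : V => s a).
  exact: ptws_eval_continuous.
have -> : state_space E R =
  \bigcap_(a in [set: E]) ((fun s : V => s a) @^-1` `[0, 1]) `&`
  \bigcap_(p in [set p : E * E * E | pea_add p.1.1 p.1.2 = Some p.2])
     ((fun s : V => s p.1.1 + s p.1.2 - s p.2) @^-1` [set 0]) `&`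
  (fun s : V => s pea_one) @^-1` [set 1].
  apply/seteqP; split=> [s [s01 sD s1]|s [[s01 sD] s1]].
    split=> //; split=> [a _|[[a b] c] /= abc]; first by rewrite /= in_itv s01.
    by rewrite (sD _ _ _ abc) subrr.
  split=> // [a|a b c abc]; first by have := s01 a I; rewrite /= in_itv.
  by apply/esym/eqP; rewrite -subr_eq0; apply/eqP; exact: (sD (a, b, c)).
apply: closedI; first apply: closedI.
- apply: closed_bigI => a _; apply: preimage_closed; last exact: interval_closed.
  by move=> s _; exact: eval_cont.
- apply: closed_bigI => -[[a b] c] _; apply: preimage_closed.
    move=> s _; have sab := continuousD (eval_cont a s) (eval_cont b s).
    exact: continuousB sab (eval_cont c s).
  exact: closed_eq.
- by apply: preimage_closed; [move=> s _; exact: eval_cont|exact: closed_eq].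
Qed.

Lemma state_space_compact : compact (state_space E R : set V).
Proof.
have cube_compact := @tychonoff {classic E} (fun=> R^o) (fun=> [set` `[0, 1]])
  (fun=> @segment_compact R 0 1).
apply: (subclosed_compact state_space_closed cube_compact).
by move=> s [s01 _ _] a; rewrite /= in_itv s01.
Qed.

End MeasureCone.

Theorem theorem4p3 (R : realType) (E : pseudoEffectAlgType) :
  RDP1 E ->
  state_space E R = set0 \/
  (state_space E R !=set0 /\ choquet_simplex (state_space E R)).
Proof.
move=> rdp; have [->|/set0P S0] := eqVneq (state_space E R) set0.
  by left.
right; split=> //; split.
- exact: ptws_hausdorff.
- exact: state_space_compact.
- exact: state_space_simplex.
Qed.
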